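(* Let $\mathcal{P}$ be a compact set of stochastic $n \times n$ matrices. Then $\mathcal{P}$ is not a consensus set if and only if there exist an integer $l$ with $1 \le l \leq 3^{n}-2^{n+1}+1$, two sequences of nonempty subsets of $\{1, \ldots, n\}$, \[ S_1, S_2, \ldots, S_l \qquad\text{and}\qquad S_1', S_2', \ldots, S_l', \] and a sequence of matrices $P(1), P(2), \ldots, P(l)$ from $\mathcal{P}$ such that \[ S_i \cap S_i' = \emptyset \quad \text{for all } i = 1, \ldots, l, \] and, for all $k = 1, \ldots, l-1$, \[ N_{k}(S_k) \subset S_{k+1}, \qquad N_{l}(S_l) \subset S_1, \] \[ N_{k}(S_k') \subset S_{k+1}', \qquad N_{l}(S_l') \subset S_1'. \] Here $N_k(S)$ denotes the set of out-neighbors of $S$ in the directed graph $G(P(k))$.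
   Context: A stochastic matrix is a square matrix with nonnegative real entries each of whose rows sums to $1$. A set $\mathcal{P}$ of stochastic $n\times n$ matrices is a consensus set if for every sequence $P(1), P(2), \ldots$ of matrices belonging to $\mathcal{P}$ and every initial state $x(0)\in\mathbb{R}^n$, the sequence defined by $x(t) = P(t)x(t-1)$, $t=1,2,\ldots$, satisfies $\lim_{t\to\infty} x(t) = \alpha \mathbf{1}$ for some scalar $\alpha$ (which may depend on $x(0)$ and on the matrix sequence), where $\mathbf{1}$ is the vector of all ones. For a stochastic matrix $P=(p_{ij}) \in \mathbb{R}^{n\times n}$, $G(P)$ is the directed graph with vertex set $\{1,\ldots,n\}$ and edge set $\{(i,j) : p_{ij}>0\}$ (self-loops allowed). For $S\subset\{1,\ldots,n\}$, $N_P(S)$ is the set of out-neighbors of $S$ in $G(P)$, i.e. $N_P(S)=\{j : p_{ij}>0 \text{ for some } i\in S\}$. Given a sequence $P(1),P(2),\ldots$, write $N_k(S)$ for $N_{P(k)}(S)$. The symbol $\subset$ allows equality. *)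

(* Defs.v *)
From mathcomp Require Import all_boot all_order all_algebra.
From mathcomp Require Import all_classical all_reals all_analysis.
Import Order.TTheory GRing.Theory Num.Theory.
Import numFieldNormedType.Exports.

Set Implicit Arguments.
Unset Strict Implicit.
Unset Printing Implicit Defensive.

Local Open Scope classical_set_scope.
Local Open Scope ring_scope.

Definition stochastic (R : realType) (n : nat) (A : 'M[R]_n) : Prop :=
  (forall i j, 0 <= A i j) /\ (forall i, \sum_j A i j = 1).

(* Matrix sequences are indexed from 1, as in x(t) = P(t) x(t-1); the value
   [P 0] is irrelevant.  Convergence is in the product topology of 'cV[R]_n. *)
Definition consensus_set (R : realType) (n : nat) (PP : set 'M[R]_n) : Prop :=
  forall P : nat -> 'M[R]_n, (forall t, (1 <= t)%N -> PP (P t)) ->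
  forall x : nat -> 'cV[R]_n, (forall t, x t.+1 = P t.+1 *m x t) ->
  exists alpha : R, x @ \oo --> alpha *: (const_mx 1 : 'cV[R]_n).

Definition digraph (R : realType) (n : nat) (A : 'M[R]_n) : rel 'I_n :=
  fun i j => 0 < A i j.

Definition out_nbrs (R : realType) (n : nat) (A : 'M[R]_n) (S : {set 'I_n}) :
    {set 'I_n} :=
  [set j | [exists i in S, digraph A i j]]%SET.

(* Main.v *)
Require Import Defs.
From mathcomp Require Import all_boot all_order all_algebra.
From mathcomp Require Import all_classical all_reals all_analysis.
Import Order.TTheory GRing.Theory Num.Theory.
Import numFieldNormedType.Exports.
From mathcomp Require Import lra zify.

Set Implicit Arguments.
Unset Strict Implicit.

Local Open Scope classical_set_scope.
Local Open Scope ring_scope.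

(** The states are read backwards in time: since [x(t)_i] is an average of the
    [x(t-1)_j] over the out-neighbours [j] of [i], the value of [x(t)] on a set
    [S] depends only on the values of [x(t-1)] on [out_nbrs (P t) S].

    Cycle implies no consensus.  Apply the matrices of the cycle periodically,
    in decreasing order of index, starting from the indicator of [S 1].  At
    every time the state is 1 on some [S k] and 0 on the matching [S' k], so
    it stays at distance at least 1/2 from every multiple of the ones vector
    ([disjoint_cycle_not_consensus]).

    No cycle implies consensus.  Let [m = 3^n - 2^(n+1) + 1]; this is the
    number of ordered pairs of disjoint nonempty subsets of the vertex set
    (3^n disjoint pairs, minus those with an empty component).  Start from two
    vertices [i], [i'] and let both singletons evolve under [out_nbrs] along [m]
    matrices of the family.  The sets stay nonempty because the matrices are
    stochastic; if they also stayed disjoint, they would give [m + 1] disjoint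
    pairs, two of which coincide by the pigeonhole principle and so close up a
    cycle ([disjoint_reach_cycle]).  Hence [i] and [i'] reach a common vertex
    [j] within [m] steps.  If every edge used has weight at least [d], then
    [x_i] is pulled towards the value at [j] from above and [x_i'] from below,
    so that [x_i - x_i'] is at most [1 - d^m] times the previous spread
    ([spread_contract]).

    Positive entries of the matrices need not be bounded away from 0, even on a
    compact family.  Compactness does provide a [d > 0] such that each [A] of
    the family dominates some [C] of the family: wherever [C] is positive, [A]
    is at least [d] ([compact_uniform_support]).  The combinatorial argument is
    run on the matrices [C], the quantitative one on the matrices [A].  The
    spread then decays geometrically, and as the range of the state never
    grows, the trajectory converges to a multiple of the ones vector
    ([shrinking_trajectory_cvg]). *)

(** * Counting disjoint pairs, and the pigeonhole principle *)

Definition disjoint_pairs (n : nat) : {set {set 'I_n} * {set 'I_n}} :=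
  [set u | [&& u.1 != finset.set0, u.2 != finset.set0
             & (u.1 :&: u.2)%SET == finset.set0]]%SET.

(** A disjoint pair is a map from the vertices to three labels (first set,
    second set, neither), so there are at most [3 ^ n] of them.  Those with an
    empty component are removed by inclusion-exclusion: [2 ^ n] for each
    component, and the pair of empty sets counted twice. *)
Lemma card_disjoint_pairs (n : nat) :
  (#|disjoint_pairs n| <= 3 ^ n + 1 - 2 ^ n.+1)%N.
Proof.
pose E := [set u : {set 'I_n} * {set 'I_n} |
  (u.1 :&: u.2)%SET == finset.set0]%SET.
pose A : {set {set 'I_n} * {set 'I_n}} :=
  finset.setX [set finset.set0]%SET [set: {set 'I_n}]%SET.
pose B : {set {set 'I_n} * {set 'I_n}} :=
  finset.setX [set: {set 'I_n}]%SET [set finset.set0]%SET.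
have cardE : (#|E| <= 3 ^ n)%N.
  pose f (u : {set 'I_n} * {set 'I_n}) : {ffun 'I_n -> option bool} :=
    [ffun x => if x \in u.1 then Some true
               else if x \in u.2 then Some false else None].
  have f_inj : {in E &, injective f}.
    move=> [S T] [S' T']; rewrite !inE /= => /eqP dST /eqP dST' /ffunP eqf.
    have dis (U V : {set 'I_n}) : (U :&: V)%SET = finset.set0 ->
        forall x, x \in U -> x \in V -> False.
      move=> UV0 x xU xV.
      by have := finset.in_set0 x; rewrite -UV0 finset.in_setI xU xV.
    congr pair; apply/finset.setP => x; move: (eqf x); rewrite !ffunE /=;
    move: (dis _ _ dST x) (dis _ _ dST' x);
    by case: (x \in S); case: (x \in T); case: (x \in S'); case: (x \in T');
       move=> // d d' e; exfalso; auto.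
  rewrite -(card_in_imset f_inj) (leq_trans (max_card _)) //.
  by rewrite card_ffun card_option card_bool card_ord.
have subE : disjoint_pairs n \subset E.
  by apply/fintype.subsetP => u; rewrite !inE => /and3P[].
have cardset : #|[set: {set 'I_n}]%SET| = (2 ^ n)%N.
  by rewrite -powersetT card_powerset cardsT card_ord.
have AIB : (A :&: B)%SET = [set (finset.set0, finset.set0)]%SET.
  by apply/finset.setP => -[S T]; rewrite !inE /= andbT xpair_eqE.
have ED : (E :\: disjoint_pairs n)%SET = (A :|: B)%SET.
  apply/finset.setP => -[S T]; rewrite !inE /= andbT.
  case: (eqVneq S finset.set0) => [->|_] /=; first by rewrite finset.set0I eqxx.
  case: (eqVneq T finset.set0) => [->|_] /=; first by rewrite finset.setI0 eqxx.
  by rewrite andNb.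
have := cardsID (disjoint_pairs n) E.
rewrite (finset.setIidPr subE) ED cardsU AIB !cardsX !cards1 cardset => cE.
move: cardE; rewrite -cE expnS.
have : (0 < 2 ^ n)%N by rewrite expn_gt0.
move: #|disjoint_pairs n| (2 ^ n)%N (3 ^ n)%N => p q r; lia.
Qed.

Lemma pigeonhole_seq (T : finType) (D : {set T}) (m : nat) (f : nat -> T) :
  (#|D| <= m)%N -> (forall k, (k <= m)%N -> f k \in D) ->
  exists p q, (p < q <= m)%N /\ f p = f q.
Proof.
move=> cardD fD; pose g (k : 'I_m.+1) := f k.
have /injectivePn[p [q pq gpq]] : ~~ injectiveb g.
  apply/negP => /injectiveP g_inj.
  have : (#|codom g| <= #|D|)%N.
    apply/subset_leq_card/fintype.subsetP => _ /codomP[k ->].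
    by apply: fD; rewrite -ltnS.
  by rewrite card_codom // card_ord leqNgt ltnS cardD.
have [lt_pq|lt_qp|/val_inj eqpq] := ltngtP p q.
- by exists p, q; rewrite lt_pq -ltnS ltn_ord.
- by exists q, p; rewrite lt_qp -ltnS ltn_ord.
- by rewrite eqpq eqxx in pq.
Qed.

(** * Averaging by a stochastic matrix *)

Lemma out_nbrsP {R : realType} {n : nat} {A : 'M[R]_n} {S : {set 'I_n}} {j} :
  reflect (exists2 i, i \in S & 0 < A i j) (j \in out_nbrs A S).
Proof.
rewrite /out_nbrs inE.
by apply: (iffP existsP) => [[i /andP[iS Aij]]|[i iS Aij]]; exists i => //;
  rewrite iS.
Qed.

Lemma out_nbrs_neq0 (R : realType) (n : nat) (A : 'M[R]_n) (S : {set 'I_n}) :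
  stochastic A -> S != finset.set0 -> out_nbrs A S != finset.set0.
Proof.
move=> [A_ge0 A_sum] /finset.set0Pn[i iS].
have [j Aij|A0] := pickP (fun j => 0 < A i j).
  by apply/finset.set0Pn; exists j; apply/out_nbrsP; exists i.
have /eqP := A_sum i; rewrite big1 ?(eq_sym 0) ?oner_eq0 // => j _.
by apply/eqP; rewrite eq_le A_ge0 andbT leNgt A0.
Qed.

Lemma stochastic_mul_out_nbrs (R : realType) (n : nat) (A : 'M[R]_n)
    (S : {set 'I_n}) (y : 'cV[R]_n) (c : R) :
  stochastic A -> (forall j, j \in out_nbrs A S -> y j 0 = c) ->
  forall i, i \in S -> (A *m y) i 0 = c.
Proof.
move=> [A_ge0 A_sum] yc i iS; rewrite mxE -[RHS]mul1r -(A_sum i) big_distrl /=.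
apply: eq_bigr => j _.
have [->|Aij0] := eqVneq (A i j) 0; first by rewrite !mul0r.
by rewrite yc //; apply/out_nbrsP; exists i; rewrite // lt0r Aij0 A_ge0.
Qed.

(** An entry of [A *m y] exceeds a lower bound of [y] by at least the
    contribution of a single edge, the others contributing nonnegatively.  This
    is the one-step estimate behind the contraction. *)
Lemma stochastic_mul_ge (R : realType) (n : nat) (A : 'M[R]_n)
    (y : 'cV[R]_n) (a d : R) (i j : 'I_n) :
  stochastic A -> (forall k, a <= y k 0) -> d <= A i j ->
  a + d * (y j 0 - a) <= (A *m y) i 0.
Proof.
move=> [A_ge0 A_sum] ay dA; rewrite mxE.
rewrite -[leLHS]addrC -lerBrDr -[in leRHS](mul1r a) -(A_sum i) big_distrl /=.
rewrite -sumrB (bigD1 j) //= -mulrBr.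
rewrite -[leLHS]addr0 lerD // ?ler_wpM2r ?subr_ge0 //.
by apply: sumr_ge0 => k _; rewrite -mulrBr mulr_ge0 // subr_ge0.
Qed.

Lemma stochastic_mul_lb (R : realType) (n : nat) (A : 'M[R]_n)
    (y : 'cV[R]_n) (a : R) :
  stochastic A -> (forall k, a <= y k 0) -> forall i, a <= (A *m y) i 0.
Proof.
move=> sA ay i; have := @stochastic_mul_ge _ _ _ _ _ 0 i i sA ay.
by rewrite mul0r addr0; apply; case: sA.
Qed.

(** * Contraction when two vertices reach a common vertex *)

Fixpoint reach {R : realType} {n : nat} (C : nat -> 'M[R]_n)
    (S : {set 'I_n}) (k : nat) : {set 'I_n} :=
  if k is k'.+1 then out_nbrs (C k') (reach C S k') else S.

(** Here [y] is a trajectory in reversed time, [y 0] being the latest state.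
    Each of the [k] edges leading from [i] to [j] keeps at least a fraction [d]
    of the excess over [a].  The edges are those of [C], their weights those of
    [B]. *)
Lemma reach_ge (R : realType) (n m : nat) (B C : nat -> 'M[R]_n)
    (y : nat -> 'cV[R]_n) (a d : R) (i : 'I_n) :
  0 <= d ->
  (forall k, (k < m)%N -> stochastic (B k) /\ y k = B k *m y k.+1) ->
  (forall k i j, (k < m)%N -> 0 < C k i j -> d <= B k i j) ->
  (forall k j, (k <= m)%N -> a <= y k j 0) ->
  forall k j, (k <= m)%N -> j \in reach C [set i]%SET k ->
  a + d ^+ k * (y k j 0 - a) <= y 0%N i 0.
Proof.
move=> d_ge0 yB CB ay; elim=> [|k IHk] j km.
  by rewrite /= inE => /eqP ->; rewrite expr0 mul1r addrC subrK.
move=> /out_nbrsP[l l_reach Clj]; apply: le_trans (IHk l (ltnW km) l_reach).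
rewrite lerD2l exprSr -mulrA ler_wpM2l ?exprn_ge0 // lerBrDl.
have [sB ->] := yB k km; apply: stochastic_mul_ge => //; last exact: CB.
by move=> ?; apply: ay.
Qed.

(** At a common vertex [j] reached after [k] steps, the excess over [a] pulls
    [y 0 i'] up and the deficit to [b] pulls [y 0 i] down, both with factor
    [d ^+ k]; excess and deficit add up to [b - a], whatever the value at [j].
*)
Lemma spread_contract (R : realType) (n m : nat) (B C : nat -> 'M[R]_n)
    (y : nat -> 'cV[R]_n) (a b d : R) (i i' : 'I_n) :
  0 <= d <= 1 ->
  (forall k, (k < m)%N -> stochastic (B k) /\ y k = B k *m y k.+1) ->
  (forall k i j, (k < m)%N -> 0 < C k i j -> d <= B k i j) ->
  (forall k j, (k <= m)%N -> a <= y k j 0 <= b) ->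
  (exists2 k, (k <= m)%N &
     (reach C [set i]%SET k :&: reach C [set i']%SET k)%SET != finset.set0) ->
  y 0%N i 0 - y 0%N i' 0 <= (1 - d ^+ m) * (b - a).
Proof.
move=> /andP[d_ge0 d_le1] yB CB yab [k km /finset.set0Pn[j]].
rewrite inE => /andP[ji ji'].
have lo : a + d ^+ k * (y k j 0 - a) <= y 0%N i' 0.
  apply: (@reach_ge _ _ m B C) => // l j' lm.
  by have /andP[] := yab l j' lm.
(* The upper bound is the lower bound for the negated trajectory. *)
have up : - b + d ^+ k * ((- y k) j 0 - - b) <= (- y 0%N) i 0.
  apply: (@reach_ge _ _ m B C (fun k => - y k)) => //.
  - by move=> ? /yB[? {1}->]; rewrite mulmxN.
  - by move=> l j' lm; rewrite mxE lerN2; have /andP[] := yab l j' lm.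
have ab : 0 <= b - a.
  by have /andP[? ?] := yab 0%N i (leq0n m); lra.
have dk : d ^+ m * (b - a) <= d ^+ k * (b - a).
  by rewrite ler_wpM2r // ler_wiXn2l.
by rewrite !mxE in up; move: lo up dk; rewrite !mulrBr mulrBl mul1r; lra.
Qed.

(** Near a fixed [C] of the family, every matrix has entries above half of the
    positive entries of [C]; compactness turns this local constant into a global
    one.  The support of [C] may be smaller than that of [A], which is why [d]
    can be uniform although small positive entries of [A] may occur. *)
Lemma compact_uniform_support (R : realType) (n : nat) (PP : set 'M[R]_n) :
  compact PP ->
  exists d : R, 0 < d <= 1 /\
    forall A, PP A -> exists2 C, PP C & forall i j, 0 < C i j -> d <= A i j.
Proof.
move=> /compact_near_coveringP cPP.
have : \forall d \near (0 : R)^'+, PP `<=` (fun A =>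
    exists2 C, PP C & forall i j, 0 < C i j -> d <= A i j).
  apply: cPP => C PC.
  pose f i j := [set z : 'M[R]_n * R | 0 < C i j -> z.2 <= z.1 i j].
  have near_f i j : \forall z \near (nbhs (C : 'M[R]_n), (0 : R)^'+), f i j z.
    have [C0|C0] := ltP 0 (C i j); last first.
      by apply: filterE => z; rewrite /f /= ltNge C0.
    exists ([set A : 'M[R]_n | C i j / 2 < A i j], [set d : R | d <= C i j / 2]).
      split=> /=; last by apply: nbhs_right_le; lra.
      apply: (cvgr_gt _ (@coord_continuous R n n i j C)); lra.
    by move=> -[A d] /= [lt le] _; apply: (le_trans le (ltW lt)).
  suff : \forall z \near (nbhs (C : 'M[R]_n), (0 : R)^'+), forall i j, f i j z.
    by apply: filterS => -[A d] /= CA; exists C.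
  have FF : Filter (nbhs (nbhs (C : 'M[R]_n), (0 : R)^'+)).
    exact: filter_prod_filter.
  refine (@filter_forall _ _ (fun i z => forall j, f i j z) _ FF _) => i.
  exact: (filter_forall FF (near_f i)).
move=> near_d.
near (0 : R)^'+ => d; exists d; split; last by near: d.
apply/andP; split; near: d; first exact: nbhs_right_gt.
exact: nbhs_right_le.
Unshelve. all: by end_near. Qed.

(** * Convergence of trajectories with vanishing spread *)

Lemma stochastic_mul_itv (R : realType) (n : nat) (A : 'M[R]_n)
    (y : 'cV[R]_n) (a b : R) :
  stochastic A -> (forall k, a <= y k 0 <= b) ->
  forall i, a <= (A *m y) i 0 <= b.
Proof.
move=> sA yab i; apply/andP; split.
  by apply: stochastic_mul_lb => // k; have /andP[] := yab k.
suff : - b <= (A *m (- y)) i 0 by rewrite mulmxN mxE lerN2.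
by apply: stochastic_mul_lb => // k; rewrite mxE lerN2; have /andP[] := yab k.
Qed.

Lemma trajectory_itv (R : realType) (n : nat) (P : nat -> 'M[R]_n)
    (x : nat -> 'cV[R]_n) (a b : R) (t : nat) :
  (forall s, stochastic (P s.+1)) -> (forall s, x s.+1 = P s.+1 *m x s) ->
  (forall i, a <= x t i 0 <= b) ->
  forall s, (t <= s)%N -> forall i, a <= x s i 0 <= b.
Proof.
move=> sP xP xab s /subnKC <-; elim: (s - t)%N => [|k IHk]; first by rewrite addn0.
by rewrite addnS xP; apply: stochastic_mul_itv.
Qed.

Lemma col_itv_of_diameter (R : realType) (n : nat) (y : 'cV[R]_n) (d : R) :
  (forall i j, y i 0 - y j 0 <= d) -> exists a, forall i, a <= y i 0 <= a + d.
Proof.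
case: n y => [|n] y yd; first by exists 0 => -[].
have [k _ y_min] := arg_minP (fun i => y i 0) (erefl : xpredT (ord0 : 'I_n.+1)).
by exists (y k 0) => i; rewrite y_min //= -lerBlDl.
Qed.

(** The interval spanned by the state is nonincreasing in time, so lower bounds
    of the state at any time stay below upper bounds at any other time.  The
    limit is the supremum of all these lower bounds: it lies in the interval
    spanned by the state at every time, and these intervals shrink to a point.
*)
Lemma shrinking_trajectory_cvg (R : realType) (n : nat) (P : nat -> 'M[R]_n)
    (x : nat -> 'cV[R]_n) :
  (forall s, stochastic (P s.+1)) -> (forall s, x s.+1 = P s.+1 *m x s) ->
  (forall e, 0 < e -> exists t, forall i j, x t i 0 - x t j 0 <= e) ->
  exists alpha : R, x @ \oo --> alpha *: (const_mx 1 : 'cV[R]_n).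
Proof.
move=> sP xP x_shrinks.
have [i0 _|n0] := pickP 'I_n; last first.
  exists 0; apply/cvg_ballP => e e_gt0; near=> t; split=> // i.
  by have := n0 i.
pose E := [set a | exists t, forall i, a <= x t i 0].
have E_le t a b a' : (forall i, a <= x t i 0 <= b) -> E a' -> a' <= b.
  move=> xab [t' a'x].
  pose s := maxn t t'.
  have /andP[_ xb] := trajectory_itv sP xP xab (leq_maxl t t') i0.
  apply: le_trans xb.
  have x't' i : a' <= x t' i 0 <= \sum_j `|x t' j 0|.
    rewrite a'x /= (le_trans (ler_norm _)) // (bigD1 i) //= lerDl.
    exact: sumr_ge0.
  by have /andP[] := trajectory_itv sP xP x't' (leq_maxr t t') i0.
(* Half of [e], because balls are open and the interval estimate is not strict. *)
exists (sup E); apply/cvg_ballP => e e_gt0.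
have [|t xt] := x_shrinks (e / 2); first lra.
have [a xa] := col_itv_of_diameter xt.
have Ea : E a by exists t; move=> k; have /andP[] := xa k.
have a_le : a <= sup E.
  by apply: ub_le_sup => //; exists (a + e / 2) => a' /(E_le _ _ _ _ xa).
have le_a : sup E <= a + e / 2.
  by apply: ge_sup; [exists a | move=> a' /(E_le _ _ _ _ xa)].
near=> s.
have ts : (t <= s)%N by near: s; exact: nbhs_infty_ge.
split=> // i j; rewrite !mxE (ord1 j) mulr1 /ball /=.
have /andP[? ?] := trajectory_itv sP xP xa ts i.
by rewrite ltr_norml; apply/andP; split; lra.
Unshelve. all: by end_near. Qed.

(** * Cycles of disjoint pairs *)

Definition disjoint_cycle (R : realType) (n : nat) (PP : set 'M[R]_n) : Prop :=
  exists (l : nat) (S S' : nat -> {set 'I_n}) (P : nat -> 'M[R]_n),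
    (1 <= l <= 3 ^ n + 1 - 2 ^ n.+1)%N /\
    (forall i, (1 <= i <= l)%N ->
       S i != finset.set0 /\ S' i != finset.set0 /\ PP (P i) /\
       (S i :&: S' i)%SET = finset.set0) /\
    (forall k, (1 <= k <= l - 1)%N ->
       out_nbrs (P k) (S k) \subset S k.+1 /\
       out_nbrs (P k) (S' k) \subset S' k.+1) /\
    out_nbrs (P l) (S l) \subset S 1%N /\
    out_nbrs (P l) (S' l) \subset S' 1%N.

(** Along the periodic sequence running through the cycle backwards, being 1 on
    the first set and 0 on the second is an invariant of the state. *)
Lemma disjoint_cycle_not_consensus (R : realType) (n : nat)
    (PP : set 'M[R]_n) (hstoch : forall A, PP A -> stochastic A) :
  disjoint_cycle PP -> ~ consensus_set PP.
Proof.
move=> [l [S [S' [P [/andP[l_gt0 _] [cycP [stepP [lastS lastS']]]]]]]] consP.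
(* The predecessor of an index in the cycle: the state at time [t] is to be
   constant on the sets of index [g t], with [g 0 = 1]. *)
pose pr k := if k == 1%N then l else k.-1.
pose g t := iter t pr 1%N.
have pr_itv k : (1 <= k <= l)%N -> (1 <= pr k <= l)%N.
  by rewrite /pr; case: eqP; lia.
have g_itv t : (1 <= g t <= l)%N.
  by elim: t => [|t IHt] /=; [rewrite l_gt0 | exact: pr_itv].
have pr_step k : (1 <= k <= l)%N ->
    out_nbrs (P (pr k)) (S (pr k)) \subset S k /\
    out_nbrs (P (pr k)) (S' (pr k)) \subset S' k.
  rewrite /pr; case: eqP => [-> //|k1 kl].
  have /stepP : (1 <= k.-1 <= l - 1)%N by lia.
  by rewrite prednK //; lia.
pose x := fix x t : 'cV[R]_n :=
  if t is s.+1 then P (g s.+1) *m x s else \col_i (i \in S 1%N)%:R.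
have sP t : stochastic (P (g t)).
  by have [_ [_ [/hstoch]]] := cycP _ (g_itv t).
have xS t : (forall i, i \in S (g t) -> x t i 0 = 1) /\
            (forall i, i \in S' (g t) -> x t i 0 = 0).
  elim: t => [|t [IH IH']].
    have [_ [_ [_ dis]]] := cycP _ (g_itv 0%N).
    split=> i iS; rewrite mxE ?iS //.
    have := finset.in_set0 i; rewrite -dis finset.in_setI iS andbT => iS1.
    by rewrite (negbTE (negbT iS1)).
  have [/fintype.subsetP sub /fintype.subsetP sub'] := pr_step _ (g_itv t).
  by split; apply: stochastic_mul_out_nbrs => // j jN;
    [apply/IH/sub | apply/IH'/sub'].
have [] := consP (fun t => P (g t)) _ x (fun t => erefl).
  by move=> t _; have [_ [_ []]] := cycP _ (g_itv t).
move=> alpha /cvg_ballP/(_ (1 / 2)) [|N _ /(_ N (leqnn N)) [_ ballN]]; first lra.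
have [/finset.set0Pn[i iS] [/finset.set0Pn[j jS] _]] := cycP _ (g_itv N).
have := ballN i 0; have := ballN j 0; rewrite /ball /= !mxE mulr1.
rewrite ((xS N).1 i iS) ((xS N).2 j jS) !ltr_norml => /andP[? ?] /andP[? ?]; lra.
Qed.

(** Two singletons whose forward images stay disjoint for [m] steps visit
    [m + 1] disjoint pairs, hence visit some pair twice; the stretch between
    the two visits is a cycle of length at most [m]. *)
Lemma disjoint_reach_cycle (R : realType) (n m : nat) (PP : set 'M[R]_n)
    (C : nat -> 'M[R]_n) (i i' : 'I_n) :
  (forall A, PP A -> stochastic A) ->
  m = (3 ^ n + 1 - 2 ^ n.+1)%N ->
  (forall k, (k < m)%N -> PP (C k)) ->
  (forall k, (k <= m)%N ->
     (reach C [set i]%SET k :&: reach C [set i']%SET k)%SET = finset.set0) ->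
  disjoint_cycle PP.
Proof.
move=> hstoch def_m PC dis.
pose T := reach C [set i]%SET; pose T' := reach C [set i']%SET.
have T_neq0 j k : (k <= m)%N -> reach C [set j]%SET k != finset.set0.
  elim: k => [|k IHk] km /=.
    by apply/finset.set0Pn; exists j; rewrite inE.
  by apply: out_nbrs_neq0 (IHk (ltnW km)); exact/hstoch/PC.
have card_m : (#|disjoint_pairs n| <= m)%N.
  by rewrite def_m card_disjoint_pairs.
have [|p [q [/andP[pq qm] [eqT eqT']]]] :=
    pigeonhole_seq (f := fun k => (T k, T' k)) card_m.
  by move=> k km; rewrite inE /= !T_neq0 //= dis.
(* Cycle indices start at 1 and reach indices at 0, hence the predecessor. *)
exists (q - p)%N, (fun k => T (p + k).-1), (fun k => T' (p + k).-1).
exists (fun k => C (p + k).-1); split; first by rewrite -def_m; lia.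
split.
  move=> k kl; have km : ((p + k).-1 < m)%N by lia.
  by rewrite !T_neq0 ?(ltnW km) // dis ?(ltnW km) //; split => //; split => //;
     split => //; apply: PC.
have stepT k j : (0 < k)%N ->
    out_nbrs (C (p + k).-1) (reach C [set j]%SET (p + k).-1) =
    reach C [set j]%SET (p + k).
  by case: k => // k _; rewrite addnS.
split=> [k /andP[k1 _]|]; first by rewrite /T /T' !stepT // addnS.
have l_gt0 : (0 < q - p)%N by lia.
rewrite /T /T' !stepT // addn1 subnKC 1?ltnW //=.
by rewrite -/(T q) -/(T' q) -eqT -eqT'.
Qed.

(** Without a cycle any two vertices meet along the dominated matrices [C], read
    backwards from time [t + m], so [spread_contract] applies to every pair. *)
Lemma trajectory_contract (R : realType) (n m : nat) (PP : set 'M[R]_n)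
    (d D : R) (P : nat -> 'M[R]_n) (x : nat -> 'cV[R]_n) (t : nat) :
  (forall A, PP A -> stochastic A) ->
  m = (3 ^ n + 1 - 2 ^ n.+1)%N ->
  ~ disjoint_cycle PP ->
  0 <= d <= 1 ->
  (forall A, PP A -> exists2 C, PP C & forall i j, 0 < C i j -> d <= A i j) ->
  (forall s, (1 <= s)%N -> PP (P s)) ->
  (forall s, x s.+1 = P s.+1 *m x s) ->
  (forall i j, x t i 0 - x t j 0 <= D) ->
  forall i j, x (t + m)%N i 0 - x (t + m)%N j 0 <= (1 - d ^+ m) * D.
Proof.
move=> hstoch def_m no_cycle d01 suppd PP_P xP xD i j.
have /choice[F PF] : forall A, exists C, PP A ->
    PP C /\ forall i j, 0 < C i j -> d <= A i j.
  move=> A; have [/suppd[C PC CA]|nPA] := pselect (PP A); first by exists C.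
  by exists A.
pose B k := P (t + m - k)%N; pose C k := F (B k).
have PB k : (k < m)%N -> PP (B k) by move=> km; apply: PP_P; lia.
have sP s : stochastic (P s.+1) by apply/hstoch/PP_P.
have [a xa] := col_itv_of_diameter xD.
have -> : D = (a + D) - a by lra.
have := @spread_contract _ _ m B C (fun k => x (t + m - k)%N) a (a + D) d i j.
rewrite subn0; apply => //.
- move=> k km; split; first exact/hstoch/PB.
  rewrite /B; have -> : (t + m - k = (t + m - k.+1).+1)%N by lia.
  exact: xP.
- by move=> k i' j' km; have [_] := PF _ (PB k km); apply.
- by move=> k j' km; apply: (trajectory_itv sP xP xa); lia.
apply: contrapT => no_meet; apply: no_cycle.
apply: (@disjoint_reach_cycle _ _ m PP C i j) => //.
  by move=> k km; have [] := PF _ (PB k km).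
move=> k km; apply: contrapT => /eqP meet; apply: no_meet; by exists k.
Qed.

(** The spread is multiplied by a factor less than 1 in every block of [m]
    steps, hence tends to 0. *)
Lemma no_cycle_consensus (R : realType) (n : nat) (PP : set 'M[R]_n)
    (hcompact : compact PP) (hstoch : forall A, PP A -> stochastic A) :
  ~ disjoint_cycle PP -> consensus_set PP.
Proof.
move=> no_cycle P PP_P x xP.
have [d [/andP[d_gt0 d_le1] suppd]] := compact_uniform_support hcompact.
pose m := (3 ^ n + 1 - 2 ^ n.+1)%N.
pose c := 1 - d ^+ m.
have c_lt1 : `|c| < 1.
  have : 0 < d ^+ m by rewrite exprn_gt0.
  have : d ^+ m <= 1 by rewrite exprn_ile1 // ltW.
  by rewrite /c ltr_norml => ? ?; apply/andP; split; lra.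
pose D := \sum_i `|x 0%N i 0| + \sum_i `|x 0%N i 0|.
have xD k i j : x (k * m)%N i 0 - x (k * m)%N j 0 <= c ^+ k * D.
  elim: k i j => [|k IHk] i j.
    rewrite expr0 mul1r mul0n /D.
    have x_le l : `|x 0%N l 0| <= \sum_i `|x 0%N i 0|.
      by rewrite (bigD1 l) //= lerDl sumr_ge0.
    have := x_le i; have := x_le j; rewrite !ler_norml => /andP[? ?] /andP[? ?].
    lra.
  rewrite mulSn addnC exprS -mulrA.
  by apply: (@trajectory_contract _ _ m PP d _ P) => //; rewrite (ltW d_gt0).
apply: (@shrinking_trajectory_cvg _ _ P) => // [s|e e_gt0]; first exact/hstoch/PP_P.
have cD : (fun k => c ^+ k * D) @ \oo --> 0 * D.
  by apply: cvgMl; exact: cvg_expr.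
rewrite mul0r in cD.
have [N _ /(_ N (leqnn N)) /= cN] := cvgr_lt _ cD _ e_gt0.
by exists (N * m)%N => i j; apply: le_trans (xD N i j) (ltW cN).
Qed.

(* The bound 3^n - 2^(n+1) + 1 is written with the subtraction last, because
   nat subtraction truncates and 3^n < 2^(n+1) when n <= 1. *)
Theorem theorem2p2 (R : realType) (n : nat) (PP : set 'M[R]_n)
    (hcompact : compact PP)
    (hstoch : forall A, PP A -> stochastic A) :
  ~ consensus_set PP <->
  exists (l : nat) (S S' : nat -> {set 'I_n}) (P : nat -> 'M[R]_n),
    (1 <= l <= 3 ^ n + 1 - 2 ^ n.+1)%N /\
    (forall i, (1 <= i <= l)%N ->
       S i != finset.set0 /\ S' i != finset.set0 /\ PP (P i) /\
       (S i :&: S' i)%SET = finset.set0) /\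
    (forall k, (1 <= k <= l - 1)%N ->
       out_nbrs (P k) (S k) \subset S k.+1 /\
       out_nbrs (P k) (S' k) \subset S' k.+1) /\
    out_nbrs (P l) (S l) \subset S 1%N /\
    out_nbrs (P l) (S' l) \subset S' 1%N.
Proof.
split=> [not_cons|]; last exact: disjoint_cycle_not_consensus.
by apply: contrapT => no_cycle; apply/not_cons/no_cycle_consensus.
Qed.
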